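(* Let $N>M\ge1$ be integers, and let $c_{w,k}$ be the passive multiplicity of shell $k$ in the target Hamming-weight-$w$ sector (defined in the context). A temperature-independent optimal permutation with identical one-qubit target marginals exists if and only if $$M\mid w\,c_{w,k}\qquad\text{for every } w=1,\dots,M-1\text{ and } k=0,\dots,N.$$
   Context: Setting: $N$ qubits, computational basis $\{|b\rangle:b\in\{0,1\}^N\}$, $P_0=1-P_1$, initial state $\rho(P_1)=(P_0|0\rangle\langle 0|+P_1|1\rangle\langle 1|)^{\otimes N}$ with $0<P_1<1/2$. The basis string with $k$ ones has eigenvalue $q_k=P_0^{N-k}P_1^k$; ''shell $k$'' is the set of the $\binom Nk$ strings with $k$ ones. The first $M$ qubits are the targets; $K_M=\sum_{\alpha=1}^M|1\rangle\langle1|_\alpha$. The target-weight-$w$ sector is the set of strings whose first $M$ bits have Hamming weight $w$; it has $\binom Mw2^{N-M}$ elements. Passive multiplicities: with $B_k=\sum_{j=0}^k\binom Nj$, $B_{-1}=0$, and $G_w=2^{N-M}\sum_{r=0}^w\binom Mr$, $G_{-1}=0$, set $$c_{w,k}=\max\{0,\ \min(B_k,G_w)-\max(B_{k-1},G_{w-1})\}.$$ This is the number of shell-$k$ eigenvalues placed in target sector $w$ when the eigenvalues, in decreasing order, fill the sectors in order of increasing $w$. A temperature-independent optimal permutation is a single permutation $\pi$ of $\{0,1\}^N$ (not depending on $P_1$) whose unitary $U_\pi|b\rangle=|\pi(b)\rangle$ minimizes $\operatorname{Tr}(K_MU\rho(P_1)U^\dagger)$ over all unitaries $U$, for every $P_1\in(0,1/2)$;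 equivalently, $\pi$ sends exactly $c_{w,k}$ strings of shell $k$ into target sector $w$, for all $w,k$. It has identical one-qubit target marginals if for every $P_1\in(0,1/2)$ the reduced states of the $M$ target qubits in $U_\pi\rho(P_1)U_\pi^\dagger$ coincide. *)

(* Defs.v *)
From mathcomp Require Import all_boot all_order all_fingroup all_algebra.
From mathcomp Require Import spectral reals complex.

Set Implicit Arguments.
Unset Strict Implicit.
Unset Printing Implicit Defensive.

Import Order.TTheory GRing.Theory Num.Theory.

Local Open Scope ring_scope.
Local Open Scope complex_scope.
Local Open Scope sesquilinear_scope.

(* {0,1}^N; also the index set of the computational basis. *)
Notation bits N := {ffun 'I_N -> 'I_2}.

(* Operators on N qubits, in the computational basis: row and column
   [enum_rank b] correspond to the basis vector |b>. *)
Notation qop R N := 'M[R[i]]_#|{: bits N}|.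

Section Qubits.
Variables (R : realType) (N : nat).
Implicit Types (pi : {perm bits N}) (U rho : qop R N).

Definition qop_of (f : bits N -> bits N -> R[i]) : qop R N :=
  \matrix_(r, s) f (enum_val r) (enum_val s).

Definition tensor (A : 'I_N -> 'M[R[i]]_2) : qop R N :=
  qop_of (fun b b' => \prod_i A i (b i) (b' i)).

Definition on_qubit (a : 'I_N) (A : 'M[R[i]]_2) : qop R N :=
  tensor (fun i => if i == a then A else 1%:M).

Definition thermal (P1 : R) : qop R N :=
  tensor (fun=> (1 - P1)%:C *: delta_mx 0 0 + P1%:C *: delta_mx 1 1).

(* The target qubits are those of index a < M. *)
Definition target_number (M : nat) : qop R N :=
  \sum_(a < N | (a < M)%N) on_qubit a (delta_mx 1 1).

(* U_pi |b> = |pi b>, acting on column vectors; [perm_mx] would give the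
   transposed matrix. *)
Definition perm_op pi : qop R N :=
  qop_of (fun b b' => (b == pi b')%:R).

Definition evolve U rho : qop R N := U *m rho *m U ^t*.

Definition set_bit (b : bits N) (a : 'I_N) (y : 'I_2) : bits N :=
  [ffun i => if i == a then y else b i].

(* Partial trace over all qubits except a:
   <x| rho_a |y> = \sum_c <x, c| rho |y, c>, where c runs over the values of
   the other bits; b = (x, c) and set_bit b a y = (y, c). *)
Definition reduced rho (a : 'I_N) : 'M[R[i]]_2 :=
  \matrix_(x, y) \sum_(b : bits N | b a == x)
    rho (enum_rank b) (enum_rank (set_bit b a y)).

(* The traces compared are real (traces of products of two Hermitian
   matrices), and on real elements the order of R[i] is that of R. *)
Definition temp_indep_optimal (M : nat) pi : Prop :=
  forall P1 : R, 0 < P1 < 1 / 2 ->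
  forall U, U \is unitarymx ->
    \tr (target_number M *m evolve (perm_op pi) (thermal P1))
      <= \tr (target_number M *m evolve U (thermal P1)).

Definition identical_marginals (M : nat) pi : Prop :=
  forall P1 : R, 0 < P1 < 1 / 2 ->
  forall a a' : 'I_N, (a < M)%N -> (a' < M)%N ->
    reduced (evolve (perm_op pi) (thermal P1)) a
      = reduced (evolve (perm_op pi) (thermal P1)) a'.

End Qubits.

Arguments temp_indep_optimal R {N} M pi.
Arguments identical_marginals R {N} M pi.

(* Cumulative sizes with strict upper bound, to accommodate the index -1:
   [shell_cum N k] is B_{k-1} and [sector_cum N M w] is G_{w-1}. *)
Definition shell_cum (N k : nat) : nat := (\sum_(j < k) 'C(N, j))%N.

Definition sector_cum (N M w : nat) : nat :=
  (2 ^ (N - M) * \sum_(r < w) 'C(M, r))%N.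

(* Truncated subtraction provides the max with 0. *)
Definition passive_mult (N M w k : nat) : nat :=
  (minn (shell_cum N k.+1) (sector_cum N M w.+1)
   - maxn (shell_cum N k) (sector_cum N M w))%N.

(* Main.v *)
Require Import Defs.
From mathcomp Require Import all_boot all_order all_fingroup all_algebra.
From mathcomp Require Import reals complex.
From mathcomp Require Import zify ring lra.

(* A permutation is optimal iff it never sends a string of a larger shell to a
   smaller target weight. For such a monotone permutation the shells and the
   preimages of the weight sectors are cut out of one chain of sets, so the cell
   (w, k) has c_{w,k} elements. Equality of the marginals for all P1 means, by
   linear independence of the q_k, that for each shell k the number of its
   strings sent to strings with bit a = 1 is the same for all targets a.

   Necessity: the total target weight is divisible by M on every union of shells
   (equal degrees) and on every union of sectors (symmetry in the targets). Each
   cell is a difference of two members of the chain, so its weight w c_{w,k} is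
   divisible by M.

   Sufficiency: among the weight-preserving rearrangements of a monotone
   permutation, take one minimizing the sum of the squared degrees
   #{b in cell : b a = 1}. Exchanging the bits a and c turns the strings with
   b a = 1, b c = 0 into edges of a digraph on the cells whose net outdegree is
   the degree difference between a and c; if a difference were at least 2,
   reversing a path from there to a cell of negative net outdegree would lower
   the sum of squares. So the degrees in a cell differ by at most 1, and they are
   equal since M divides their sum w c_{w,k}. *)

Set Implicit Arguments.
Unset Strict Implicit.
Unset Printing Implicit Defensive.

(** * Weights and counting *)

Definition weight N (M : nat) (b : bits N) : nat := \sum_(i < N | i < M) b i.

Lemma bit_eq1 (y : 'I_2) : y = (y == 1%R) :> nat.
Proof. by case: y => [[|[|//]]] ?. Qed.

Lemma weight_le N M (b : bits N) : weight M b <= N.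
Proof.
rewrite -[leqRHS]card_ord -sum1_card /weight [leqRHS](bigID (fun i : 'I_N => i < M)) /=.
by apply: leq_trans (leq_addr _ _); apply: leq_sum => i _; rewrite -ltnS.
Qed.

Lemma weight_le_targets N M (b : bits N) : weight M b <= M.
Proof.
rewrite /weight; apply: (@leq_trans (\sum_(i < N | i < M) 1)).
  by apply: leq_sum => i _; rewrite -ltnS.
rewrite (big_ord_widen_cond (maxn N M) (fun i => i < M) (fun=> 1)) ?leq_maxl //.
apply: (@leq_trans (\sum_(i < maxn N M | i < M) 1)).
  by rewrite big_mkcond [leqRHS]big_mkcond leq_sum // => i _; case: (i < M); case: (i < N).
by rewrite -(big_ord_widen (maxn N M) (fun=> 1)) ?leq_maxr // sum1_card card_ord.
Qed.

Section Counting.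
Import GRing.Theory.
Local Open Scope ring_scope.

(** Generating function: both sides are the coefficient of ['X^r] in the product over the qubits of
    [1 + 'X] for a target and 2 otherwise. *)
Lemma card_weight N M r : (M <= N)%N ->
  #|[set b : bits N | weight M b == r]| = (2 ^ (N - M) * 'C(M, r))%N.
Proof.
move=> leMN.
pose F (i : 'I_N) (y : 'I_2) : {poly int} := if (i < M)%N then 'X^y else 1.
have E : \prod_i \sum_y F i y = \sum_(b : bits N) 'X^(weight M b).
  rewrite bigA_distr_bigA /=; apply: eq_bigr => b _.
  by rewrite /F -big_mkcond /= /weight -prodrXr.
have E2 : \prod_i \sum_y F i y = (2 ^ (N - M))%N%:R * (1 + 'X) ^+ M :> {poly int}.
  rewrite (eq_bigr (fun i : 'I_N => if (i < M)%N then 1 + 'X else 2%:R)); last first.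
    by move=> i _; rewrite /F !big_ord_recl big_ord0 addr0; case: ifP.
  rewrite -[LHS](big_mkord xpredT (fun i => if (i < M)%N then 1 + 'X else 2%:R)).
  rewrite (big_cat_nat (n := M)) //= mulrC natrX; congr (_ * _).
    rewrite big_nat_cond (eq_bigr (fun=> 2%:R)); last first.
      by move=> i /andP[/andP[+ _] _]; rewrite leqNgt => /negbTE->.
    by rewrite -big_nat_cond prodr_const_nat.
  rewrite big_nat_cond (eq_bigr (fun=> 1 + 'X)); last by move=> i /andP[/andP[_ ->]].
  by rewrite -big_nat_cond prodr_const_nat subn0.
have := congr1 (fun p : {poly int} => p`_r) (etrans (esym E) E2).
rewrite coef_sum (eq_bigr (fun b : bits N => (weight M b == r)%:R)); last first.
  by move=> b _; rewrite coefXn eq_sym.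
rewrite mulr_natl coefMn addrC exprD1n coef_sum.
rewrite (eq_bigr (fun i : 'I_M.+1 => (if r == i then 'C(M, r) else 0)%:R)); last first.
  by move=> i _; rewrite coefMn coefXn; case: eqP => [->|_]; rewrite ?mul0rn.
rewrite -!natr_sum -mulrnA => /eqP.
rewrite Num.Theory.eqr_nat => /eqP H.
rewrite -sum1_card big_mkcond /=.
transitivity (\sum_(i : bits N) (weight M i == r))%N; first by apply: eq_bigr => b _; rewrite inE; case: (_ == _).
rewrite H mulnC; congr muln.
rewrite -big_mkcond /=; case: (ltnP r M.+1) => h.
  by rewrite (big_pred1 (Ordinal h)).
by rewrite bin_small // big1.
Qed.

End Counting.

(** * Balancing *)

Section Balancing.
Variables (N M : nat) (K : finType).
Implicit Types (g : bits N -> K) (b x : bits N) (a c : 'I_N) (k l : K).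

Definition swap_bits a c b : bits N := [ffun i => b (tperm a c i)].

Lemma swap_bitsK a c : involutive (swap_bits a c).
Proof. by move=> b; apply/ffunP=> i; rewrite !ffunE tpermK. Qed.

Lemma swap_bits_id a c b : b a = b c -> swap_bits a c b = b.
Proof. by move=> E; apply/ffunP=> i; rewrite ffunE; case: tpermP => [->|->|]. Qed.

Lemma weight_swap a c b : a < M -> c < M -> weight M (swap_bits a c b) = weight M b.
Proof.
move=> aM cM; rewrite /weight [RHS](reindex_inj (@perm_inj _ (tperm a c))) /=.
by apply: eq_big => [i|i _]; rewrite ?ffunE //; case: tpermP => [->|->|]; rewrite ?aM ?cM.
Qed.

(** Strings are hyperedges on the qubits, labelled by [g] with a cell; this is the degree of the
    vertex [a] in cell [k]. *)
Definition degree g k a : nat := \sum_(b | g b == k) b a.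

(** To avoid truncated subtraction, the lost contributions of [x] and [y] stand on the left, the
    gained ones on the right. *)
Lemma degree_tperm g k x y a : x != y ->
  degree (g \o tperm x y) k a + (g x == k) * x a + (g y == k) * y a =
  degree g k a + (g x == k) * y a + (g y == k) * x a.
Proof.
move=> xy.
have D h : degree h k a = (h x == k) * x a + ((h y == k) * y a +
    \sum_(b | (b != x) && (b != y)) (h b == k) * b a).
  rewrite /degree big_mkcond (bigD1 x) //= (bigD1 y) 1?eq_sym //=.
  by congr (_ + (_ + _)); try (case: ifP); rewrite ?mul0n ?mul1n //;
     apply: eq_bigr => b _; case: ifP; rewrite ?mul0n ?mul1n.
rewrite !D /= tpermL tpermR.
rewrite (eq_bigr (fun b => (g b == k) * b a)); first lia.
by move=> b /andP[bx bY]; rewrite tpermD // eq_sym.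
Qed.

(** Multiplicities of edges are dropped: only reachability of cells matters. *)
Definition swap_edge a c g k l :=
  [exists x : bits N, [&& x a == 1%R, x c == 0%R, g x == k & g (swap_bits a c x) == l]].

(** Reversing an edge exchanges the labels of its string [x] and of [swap_bits a c x]; these differ
    only at [a] and [c], so the other degrees are kept. Along the path the changes telescope: one
    unit of [a]-degree moves from the first cell to the last, one unit of [c]-degree moves back. *)
Lemma reverse_path a c g k p : a < M -> c < M -> a != c ->
  path (swap_edge a c g) k p -> uniq (k :: p) ->
  exists s : {perm bits N},
    [/\ forall b, weight M (s b) = weight M b,
        forall l d, d != a -> d != c -> degree (g \o s) l d = degree g l d,
        forall l, degree (g \o s) l a + (k == l) = degree g l a + (last k p == l)
      & forall l, degree (g \o s) l c + (last k p == l) = degree g l c + (k == l)].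
Proof.
move=> aM cM ac; elim: p k g => [|k1 p IH] k g.
  have D1 l d : degree (g \o (1%g : {perm bits N})) l d = degree g l d.
    by apply: eq_bigl => b; rewrite /= perm1.
  by move=> _ _; exists 1%g; split=> *; rewrite ?perm1 // D1.
rewrite [path _ _ _]/= => /andP[/existsP[x /and4P[/eqP xa /eqP xc /eqP gx /eqP gy]] pth].
rewrite [uniq _]/= => /andP[kp up].
set y := swap_bits a c x in gy.
have ya : y a = 0%R by rewrite ffunE tpermL.
have yc : y c = 1%R by rewrite ffunE tpermR.
have yd d : d != a -> d != c -> y d = x d.
  by move=> da dc; rewrite ffunE tpermD // eq_sym.
have xy : x != y by apply/eqP => E; move: xa; rewrite E ya.
pose t := tperm x y.
have wy : weight M y = weight M x by rewrite weight_swap.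
have tw b : weight M (t b) = weight M b by rewrite /t; case: tpermP => [->|->|].
(* The later edges survive: their strings are neither [x], whose cell [k] does not recur on the
   path, nor [y], whose bits are the wrong way round; likewise for the exchanged strings. *)
have pth1 : path (swap_edge a c (g \o t)) k1 p.
  apply: (@sub_in_path _ (mem (k1 :: p)) (swap_edge a c g)) pth; last exact/allP.
  move=> u v ku kv /existsP[z /and4P[za zc gz gyz]]; apply/existsP; exists z.
  have nx : x != z.
    by apply: contraNneq kp => E; move: gz; rewrite -E gx => /eqP kE; rewrite kE; exact: ku.
  have ny : y != z by apply: contraTneq za => <-; rewrite ya.
  have nx' : x != swap_bits a c z.
    by apply: contraTneq zc => E; rewrite -[z](swap_bitsK a c) -E -/y yc.
  have ny' : y != swap_bits a c z.
    by apply: contraNneq nx => /(congr1 (swap_bits a c)); rewrite /y !swap_bitsK => ->.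
  by rewrite za zc /= /t !tpermD // gz gyz.
have [s [sw sd sa sc]] := IH k1 (g \o t) pth1 up.
have E f l d : degree (f \o t \o s) l d = degree (f \o (s * t)%g) l d.
  by apply: eq_bigl => b; rewrite /= permM.
exists (s * t)%g; split.
- by move=> b; rewrite permM tw sw.
- move=> l d da dc; rewrite -E sd //.
  by have := degree_tperm g l d xy; rewrite (yd d) // => /addIn/addIn.
- move=> l; rewrite -E /=; have := degree_tperm g l a xy; have := sa l.
  rewrite -/t xa ya gx gy !muln0 !muln1 !addn0.
  by move: (degree _ _ _) (degree _ _ _) (degree _ _ _) => u v w; lia.
- move=> l; rewrite -E /=; have := degree_tperm g l c xy; have := sc l.
  rewrite -/t xc yc gx gy !muln0 !muln1 !addn0.
  by move: (degree _ _ _) (degree _ _ _) (degree _ _ _) => u v w; lia.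
Qed.

(** Otherwise the total [a]-degree over the cells reachable from [k] would exceed the total
    [c]-degree; but these cells are closed under edges, so exchanging the bits injects the strings
    counted at [a] into those counted at [c]. *)
Lemma deficient_reachable a c g k : degree g k c < degree g k a ->
  exists2 l, connect (swap_edge a c g) k l & degree g l a < degree g l c.
Proof.
move=> kca; apply/exists_inP; rewrite -[X in is_true X]negbK negb_exists_in.
apply/negP => /forall_inP H.
pose R := connect (swap_edge a c g) k.
have S d : \sum_(l | R l) degree g l d = \sum_b (R (g b)) * b d.
  rewrite /degree (exchange_big_dep xpredT) //=; apply: eq_bigr => b _.
  case Rb: (R (g b)).
    rewrite mul1n (big_pred1 (g b)) // => l.
    by rewrite /= eq_sym; case: eqP => [->|]; rewrite ?Rb ?andbF.
  by rewrite big1 // => l /andP[Rl /eqP E]; rewrite -E Rb in Rl.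
have lt : \sum_(l | R l) degree g l c < \sum_(l | R l) degree g l a.
  rewrite (bigD1 k) /=; last exact: connect0.
  rewrite [ltnRHS](bigD1 k) /=; last exact: connect0.
  rewrite -addSn leq_add // leq_sum // => l /andP[/H + _].
  by rewrite -leqNgt.
move: lt; rewrite ltnNge !S => /negP; apply.
rewrite [leqRHS](reindex_inj (inv_inj (swap_bitsK a c))) /=; apply: leq_sum => b _.
rewrite [swap_bits _ _ _ c]ffunE tpermR.
have [E|ne] := eqVneq (b a) (b c); first by rewrite swap_bits_id.
move: ne; rewrite -val_eqE /= !bit_eq1.
have [ba|] := eqVneq (b a) 1%R; last by rewrite muln0.
have [//|bc] := eqVneq (b c) 1%R; move=> _ /=; rewrite !muln1.
case Rb: (R (g b)) => //; rewrite (_ : R _ = true) //.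
apply: connect_trans Rb _; apply: connect1; apply/existsP; exists b.
rewrite ba !eqxx /= andbT.
by move: bc; rewrite -!val_eqE /= !bit_eq1; case: (b c) => [[|[|]]].
Qed.

Lemma balancing g : exists s : {perm bits N},
  (forall b, weight M (s b) = weight M b) /\
  forall k a c, a < M -> c < M -> degree (g \o s) k a <= (degree (g \o s) k c).+1.
Proof.
pose ok (s : {perm bits N}) := [forall b, weight M (s b) == weight M b].
pose pot (s : {perm bits N}) := \sum_k \sum_a degree (g \o s) k a ^ 2.
have ok1 : ok 1%g by apply/forallP=> b; rewrite perm1.
case: (arg_minnP pot ok1) => s /forallP sok smin.
exists s; split=> [b|k a c aM cM]; first exact/eqP.
rewrite leqNgt; apply/negP => big.
have ac : a != c by apply: contraTneq big => ->; rewrite -leqNgt leqnSn.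
have [l /connectP[p0 pth0 lE] def] := deficient_reachable (ltnW big).
case/shortenP: pth0 lE => p pth up _ lE.
have [t [tw td ta tc]] := reverse_path aM cM ac pth up.
have kl : k != l by apply: contraTneq def => <-; rewrite -leqNgt; lia.
suff : pot (t * s)%g < pot s.
  rewrite ltnNge smin //; apply/forallP=> b.
  by rewrite permM (eqP (sok _)) tw.
have E m d : degree (g \o (t * s)%g) m d = degree (g \o s \o t) m d.
  by apply: eq_bigl => b; rewrite /= permM.
have split2 h m : \sum_d degree h m d ^ 2 =
    degree h m a ^ 2 + (degree h m c ^ 2 + \sum_(d | (d != a) && (d != c)) degree h m d ^ 2).
  by rewrite (bigD1 a) //= (bigD1 c) 1?eq_sym.
have rest m : \sum_(d | (d != a) && (d != c)) degree (g \o (t * s)%g) m d ^ 2 =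
              \sum_(d | (d != a) && (d != c)) degree (g \o s) m d ^ 2.
  by apply: eq_bigr => d /andP[da dc]; rewrite E td.
(* At [k] the degrees at [a] and [c] differ by at least 2 and move one unit towards each other: a
   strict drop. *)
rewrite /pot (bigD1 k) //= [ltnRHS](bigD1 k) //= -addSn leq_add //.
  rewrite !split2 rest !E; move: (ta k) (tc k).
  rewrite eqxx -lE [l == k]eq_sym (negbTE kl) /=.
  move: big; move: (degree _ _ _) (degree _ _ _) (degree _ _ _) (degree _ _ _).
  by move=> u v u' v' ? ? ?; rewrite !addnA ltn_add2r -!mulnn; nia.
(* At [l] the degree at [a] is below that at [c], so the opposite move does not raise the sum of
   squares; the other cells do not change. *)
apply: leq_sum => m mk; rewrite !split2 rest !E; move: (ta m) (tc m).
rewrite -lE [k == m]eq_sym (negbTE mk); case: eqP => [<-|_] /=.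
  move: def; move: (degree _ _ _) (degree _ _ _) (degree _ _ _) (degree _ _ _).
  by move=> u v u' v' ? ? ?; rewrite !addnA leq_add2r -!mulnn; nia.
by rewrite !addn0 => -> ->.
Qed.

End Balancing.

(** * Monotone permutations *)

Definition monotone N M (pi : {perm bits N}) :=
  forall b b' : bits N, weight N b < weight N b' -> weight M (pi b) <= weight M (pi b').

(** The coefficient of the eigenvalue of shell [k] in the excited population of qubit [a] after
    [pi]. *)
Definition shell_degree N (pi : {perm bits N}) (k : nat) (a : 'I_N) : nat :=
  \sum_(b | weight N b == k) pi b a.

Section Monotone.
Import Order.TTheory GRing.Theory Num.Theory.
Local Open Scope ring_scope.

(** If a smaller shell were sent to a larger weight, exchanging the two images would lower the cost
    by a product of two positive differences. *)
Lemma minimal_monotone (F : numDomainType) N M (q : nat -> F) (pi : {perm bits N}) :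
  (forall i j, (i < j)%N -> q j < q i) ->
  (forall pi' : {perm bits N}, \sum_b q (weight N b) * (weight M (pi b))%:R
     <= \sum_b q (weight N b) * (weight M (pi' b))%:R) ->
  monotone M pi.
Proof.
move=> qdec opt b b' bb'; rewrite leqNgt; apply/negP => lt.
have ne : b' != b by apply: contraTneq bb' => ->; rewrite ltnn.
have := opt (tperm b b' * pi)%g.
rewrite (bigD1 b) //= (bigD1 b') //= [leRHS](bigD1 b) //= [X in _ <= _ + X](bigD1 b') //=.
rewrite !permM tpermL tpermR !addrA.
rewrite [X in _ <= _ + X](eq_bigr (fun x => q (weight N x) * (weight M (pi x))%:R)); last first.
  by move=> x /andP[xb xb']; rewrite permM tpermD // eq_sym.
rewrite lerD2r -subr_ge0.
set u := (weight M (pi b))%:R; set v := (weight M (pi b'))%:R.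
set Q := q _; set Q' := q _.
have -> : Q * v + Q' * u - (Q * u + Q' * v) = - ((Q - Q') * (u - v)).
  by ring.
rewrite oppr_ge0 => le0.
have : 0 < (Q - Q') * (u - v) by rewrite mulr_gt0 ?subr_gt0 ?qdec ?ltr_nat.
by move=> /lt_le_trans/(_ le0); rewrite ltxx.
Qed.

(** The populations [- k] are strictly decreasing and give an integer cost, which has a minimizer
    among the finitely many permutations. *)
Lemma monotone_exists N M : exists pi : {perm bits N}, monotone M pi.
Proof.
pose cost (pi : {perm bits N}) : int :=
  \sum_(b : bits N) - (weight N b)%:R * (weight M (pi b))%:R.
case: (@arg_minP _ _ _ 1%g xpredT cost isT) => pi _ piP; exists pi.
apply: (@minimal_monotone int N M (fun k => - k%:R)) => [i j ij|pi']; last exact: piP.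
by rewrite ltrN2 ltr_nat.
Qed.

End Monotone.

(** * Sector sizes and sums over the targets *)

Lemma card_weight_lt N M r : M <= N ->
  #|[set b : bits N | weight M b < r]| = sector_cum N M r.
Proof.
move=> leMN; rewrite /sector_cum; elim: r => [|r IH].
  by rewrite big_ord0 muln0; apply: eq_card0 => b; rewrite inE.
rewrite big_ord_recr /= mulnDr -IH -card_weight // -cardsUI.
rewrite [X in _ + X](_ : _ = 0) ?addn0; last first.
  by apply: eq_card0 => b; rewrite !inE; lia.
by congr #|pred_of_set _|; apply/setP=> b; rewrite !inE ltnS leq_eqVlt orbC.
Qed.

Lemma sum_targets N M (F : nat -> nat) : M <= N ->
  \sum_(a < N | a < M) F a = \sum_(a < M) F a.
Proof. by move=> leMN; rewrite -(big_ord_widen N F). Qed.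

Lemma dvdn_targets N M (F : 'I_N -> nat) : M <= N ->
  (forall a c : 'I_N, a < M -> c < M -> F a = F c) -> M %| \sum_(a < N | a < M) F a.
Proof.
move=> leMN Feq; case: M leMN Feq => [|M] leMN Feq; first by rewrite big_pred0.
have M0 : 0 < N by apply: leq_trans leMN.
rewrite (eq_bigr (fun=> F (Ordinal M0))) => [|a aM]; last exact: Feq.
by rewrite (sum_targets (fun=> F (Ordinal M0))) // sum_nat_const card_ord dvdn_mulr.
Qed.

(** If [F a > F c], all target values are [F c] or [F c + 1], so their sum is [M * F c] plus an
    excess that is positive because of [a] and less than [M] because of [c]. *)
Lemma almost_regular_eq N M (F : 'I_N -> nat) : M <= N ->
  (forall a c : 'I_N, a < M -> c < M -> F a <= (F c).+1) ->
  M %| \sum_(a < N | a < M) F a ->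
  forall a c : 'I_N, a < M -> c < M -> F a = F c.
Proof.
move=> leMN Fle dvdF.
suff H (a c : 'I_N) : a < M -> c < M -> F a <= F c.
  by move=> a c aM cM; apply/eqP; rewrite eqn_leq !H.
move=> aM cM; rewrite leqNgt; apply/negP => lt.
have cst m : \sum_(d < N | d < M) m = M * m.
  by rewrite (sum_targets (fun=> m)) // sum_nat_const card_ord.
have Fc (d : 'I_N) : d < M -> F c <= F d <= (F c).+1.
  by move=> dM; rewrite Fle // andbT -ltnS (leq_trans lt) ?Fle.
have E : \sum_(d < N | d < M) F d = M * F c + \sum_(d < N | d < M) (F d - F c).
  by rewrite -cst -big_split; apply: eq_bigr => d /Fc/andP[? _]; rewrite /= subnKC.
move: dvdF; rewrite E dvdn_addr ?dvdn_mulr // => /dvdn_leq.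
have pos : 0 < \sum_(d < N | d < M) (F d - F c).
  by rewrite (bigD1 a) //= addn_gt0 subn_gt0 lt.
move=> /(_ pos); rewrite leqNgt => /negP; apply.
rewrite -[ltnRHS](muln1 M) -cst (bigD1 c) //= [ltnRHS](bigD1 c) //= subnn add0n add1n ltnS.
by apply: leq_sum => d /andP[/Fc/andP[_ ?] _]; lia.
Qed.

Lemma sum_weight N M (pi : {perm bits N}) (S : pred (bits N)) :
  \sum_(b | S b) weight M (pi b) = \sum_(a < N | a < M) \sum_(b | S b) pi b a.
Proof. exact: exchange_big. Qed.

(** * Cells of a monotone permutation *)

Section Cells.
Variables (N M : nat) (pi : {perm bits N}).
Hypotheses (leMN : M <= N) (pi_mono : monotone M pi).

Let X k := [set b : bits N | weight N b < k].
Let Y w := [set b : bits N | weight M (pi b) < w].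
Local Notation cell w k :=
  [set b : bits N | (weight N b == k) && (weight M (pi b) == w)].

Let card_X k : #|X k| = shell_cum N k.
(* Shells are the sectors with all qubits as targets. *)
Proof. by rewrite card_weight_lt // /sector_cum subnn mul1n. Qed.

Let card_Y w : #|Y w| = sector_cum N M w.
Proof.
rewrite -card_weight_lt // -[RHS](card_preimset _ (@perm_inj _ pi)).
by apply: eq_card => b; rewrite !inE.
Qed.

(** A string in [X k] outside [Y w] and one in [Y w] outside [X k] would together violate
    monotonicity. *)
Let nested k w : X k \subset Y w \/ Y w \subset X k.
Proof.
have [|/subsetPn[b]] := boolP (X k \subset Y w); first by left.
rewrite !inE -leqNgt => bk wb; right; apply/subsetP => b'; rewrite !inE => b'w.
rewrite ltnNge; apply/negP => kb'.
have /pi_mono := leq_trans bk kb'; rewrite leqNgt.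
by rewrite (leq_trans b'w wb).
Qed.

(** A cell is [X k.+1 :&: Y w.+1] minus [X k :|: Y w]. In a chain the intersection is the smaller
    set and the union the larger one, whence the min and max in [passive_mult]; the truncation
    covers the case [A \subset B] of an empty cell. *)
Lemma cell_chain w k : exists A B : {set bits N},
  [/\ A = X k.+1 \/ A = Y w.+1, B = X k \/ B = Y w, B \subset A \/ A \subset B,
      cell w k = A :\: B & #|A :\: B| = passive_mult N M w k].
Proof.
have sX : X k \subset X k.+1 by apply/subsetP=> b; rewrite !inE => /ltnW.
have sY : Y w \subset Y w.+1 by apply/subsetP=> b; rewrite !inE => /ltnW.
have E : cell w k = (X k.+1 :&: Y w.+1) :\: (X k :|: Y w).
  by apply/setP=> b; rewrite !inE; lia.
pose A := X k.+1 :&: Y w.+1; pose B := X k :|: Y w.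
have [EA cA] : (A = X k.+1 \/ A = Y w.+1) /\ #|A| = minn (shell_cum N k.+1) (sector_cum N M w.+1).
  rewrite -card_X -card_Y /A; case: (nested k.+1 w.+1) => s; move: (subset_leq_card s).
    by move=> /minn_idPl->; rewrite (setIidPl s); split; [left|].
  by move=> /minn_idPr->; rewrite (setIidPr s); split; [right|].
have [EB cB] : (B = X k \/ B = Y w) /\ #|B| = maxn (shell_cum N k) (sector_cum N M w).
  rewrite -card_X -card_Y /B; case: (nested k w) => s; move: (subset_leq_card s).
    by move=> /maxn_idPr->; rewrite (setUidPr s); split; [right|].
  by move=> /maxn_idPl->; rewrite (setUidPl s); split; [left|].
have AB : B \subset A \/ A \subset B.
  case: EA => ->; case: EB => ->; by [left | case: (nested k.+1 w); [right|left]
    | case: (nested k w.+1); [left|right]].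
exists A, B; split=> //.
rewrite /passive_mult -cA -cB; case: AB => s; first by rewrite cardsDS.
rewrite (eqP (introT eqP (eqP _ : A :\: B = set0))) ?setD_eq0 // cards0.
by apply/esym/eqP; rewrite subn_eq0 subset_leq_card.
Qed.

Lemma card_cell w k : #|cell w k| = passive_mult N M w k.
Proof. by have [A [B [_ _ _ -> ->]]] := cell_chain w k. Qed.

Lemma dvdn_of_shell_degree :
  (forall k (a c : 'I_N), a < M -> c < M -> shell_degree pi k a = shell_degree pi k c) ->
  forall w k, M %| w * passive_mult N M w k.
Proof.
move=> deg_eq w k.
have dX j : M %| \sum_(b in X j) weight M (pi b).
  rewrite sum_weight; apply: dvdn_targets => // a c aM cM.
  elim: j => [|j IH]; first by rewrite !big_pred0 // => b; rewrite inE.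
  have R d : \sum_(b in X j.+1) pi b d = shell_degree pi j d + \sum_(b in X j) pi b d.
    rewrite (bigID (fun b => weight N b == j)) /=; congr (_ + _);
      by apply: eq_bigl => b; rewrite !inE; lia.
  by rewrite !R IH (deg_eq _ a c).
(* The images of [Y j] are all strings of target weight below [j], a set symmetric under exchange of
   two targets. *)
have dY j : M %| \sum_(b in Y j) weight M (pi b).
  rewrite sum_weight; apply: dvdn_targets => // a c aM cM.
  have R d : \sum_(b in Y j) pi b d = \sum_(x : bits N | weight M x < j) x d.
    by rewrite [RHS](reindex_inj (@perm_inj _ pi)); apply: eq_bigl => b; rewrite inE.
  rewrite !R (reindex_inj (inv_inj (swap_bitsK a c))) /=.
  by apply: eq_big => [x|x _]; rewrite ?weight_swap // ffunE tpermL.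
have [A [B [EA EB AB Ecell cAB]]] := cell_chain w k.
have dA : M %| \sum_(b in A) weight M (pi b) by case: EA => ->.
have dB : M %| \sum_(b in B) weight M (pi b) by case: EB => ->.
have -> : w * passive_mult N M w k = \sum_(b in A :\: B) weight M (pi b).
  rewrite -cAB mulnC -sum_nat_const -Ecell; apply: eq_bigr => b.
  by rewrite inE => /andP[_ /eqP].
case: AB => s; last by move: s; rewrite -setD_eq0 => /eqP->; rewrite big_set0.
by move: dA; rewrite (big_setID B) /= (setIidPr s) dvdn_addr.
Qed.

End Cells.

(** Balancing is applied to the image strings, labelled by target weight and by the shell of the
    preimage; as it preserves weights, monotonicity is kept. *)
Lemma balanced_exists N M : 0 < M -> M <= N ->
  (forall w k, 1 <= w -> w <= M - 1 -> k <= N -> M %| w * passive_mult N M w k) ->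
  exists pi : {perm bits N}, monotone M pi /\
    forall k (a c : 'I_N), a < M -> c < M -> shell_degree pi k a = shell_degree pi k c.
Proof.
move=> M0 leMN dvd; have [pi0 mono0] := monotone_exists N M.
pose f (b : bits N) : 'I_N.+1 * 'I_N.+1 :=
  (inord (weight M b), inord (weight N ((pi0^-1)%g b))).
have [s [sw sdeg]] := balancing M f.
(* With the inverse, the preimage of [x] under [pi] is that of [s x] under [pi0], so [f (s x)] is
   the label of [x] for [pi]. *)
pose pi := (pi0 * s^-1)%g.
have piw b : weight M (pi b) = weight M (pi0 b) by rewrite permM -sw permKV.
have mono : monotone M pi by move=> b b' /mono0; rewrite !piw.
exists pi; split=> // k a c aM cM.
have [kN|kN] := leqP k N; last first.
  by rewrite /shell_degree !big_pred0 // => b; apply/negbTE; have := weight_le N b; lia.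
pose cd w d := \sum_(b | (weight N b == k) && (weight M (pi b) == w)) pi b d.
have cdE w d : w <= N -> cd w d = degree (f \o s) (inord w, inord k) d.
  move=> wN; rewrite /cd /degree [RHS](reindex_inj (@perm_inj _ pi)) /=.
  apply: eq_bigl => b; rewrite /f xpair_eqE -!val_eqE /= !inordK ?ltnS ?weight_le //.
  by rewrite sw andbC /pi permM permKV permK.
have split_deg d : shell_degree pi k d = \sum_(w < N.+1) cd w d.
  rewrite /shell_degree (partition_big (fun b => inord (weight M (pi b)) : 'I_N.+1) xpredT) //=.
  apply: eq_bigr => w _; apply: eq_bigl => b.
  by rewrite -val_eqE /= inordK // ltnS weight_le.
rewrite !split_deg; apply: eq_bigr => w _.
have lewN : w <= N by rewrite -ltnS.
have sum_cd : \sum_(d < N | d < M) cd w d = w * passive_mult N M w k.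
  rewrite -(card_cell leMN mono) mulnC -sum_nat_const -sum_weight.
  by rewrite [RHS](eq_bigl _ _ (fun b => in_set _ b)); apply: eq_bigr => b /andP[_ /eqP].
have dvd_cd : M %| \sum_(d < N | d < M) cd w d.
  (* Weights 0 and [M] give trivial divisibility; cells of weight above [M] are empty. *)
  rewrite sum_cd; have [->|w0] := posnP w; first by rewrite mul0n.
  have [->|wM] := eqVneq (w : nat) M; first exact: dvdn_mulr.
  have [wlt|wgt] := ltnP w M; first by apply: dvd => //; lia.
  rewrite -(card_cell leMN mono) (_ : #|_| = 0) ?muln0 //.
  apply: eq_card0 => b; rewrite !inE; apply/negbTE.
  by have := weight_le_targets M (pi b); lia.
have cd_le (d e : 'I_N) : d < M -> e < M -> cd w d <= (cd w e).+1.
  by move=> dM eM; rewrite !cdE ?sdeg.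
exact: almost_regular_eq dvd_cd _ _ _ _.
Qed.

(** * Populations and optimal transport *)

Import Order.TTheory GRing.Theory Num.Theory.
Local Open Scope ring_scope.
Local Open Scope complex_scope.
Local Open Scope sesquilinear_scope.

(** The eigenvalue q_k. For [k > N] the exponent [N - k] truncates to 0, and the values [P ^+ k]
    continue the decreasing sequence. *)
Definition shell_pop (R : pzRingType) (N : nat) (P : R) (k : nat) : R :=
  (1 - P) ^+ (N - k) * P ^+ k.

Lemma shell_pop_ge0 (R : realFieldType) N (P : R) k : 0 < P < 1 / 2 -> 0 <= shell_pop N P k.
Proof. by move=> h; rewrite mulr_ge0 // exprn_ge0 //; lra. Qed.

Lemma shell_pop_lt (R : realFieldType) N (P : R) i j : 0 < P < 1 / 2 -> (i < j)%N ->
  shell_pop N P j < shell_pop N P i.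
Proof.
move=> h; have := @Order.NatMonotonyTheory.nhomo_ltn_lt _ _ (shell_pop N P).
apply=> {i j} k.
have P0 : 0 < P ^+ k by rewrite exprn_gt0 //; lra.
rewrite /shell_pop exprS; have [kN|kN] := ltnP k N; last first.
  have -> : (N - k)%N = 0%N by lia.
  have -> : (N - k.+1)%N = 0%N by lia.
  by nra.
have -> : (N - k)%N = (N - k.+1).+1 by lia.
have : 0 < (1 - P) ^+ (N - k.+1) by rewrite exprn_gt0 //; lra.
rewrite [(1 - P) ^+ _.+1]exprS; set u := _ ^+ _ => u0.
have : 0 < u * P ^+ k by rewrite mulr_gt0.
by nra.
Qed.

(** With [P = x / (1 + x)], multiplication by [(1 + x) ^+ N] turns the sum into the polynomial with
    coefficients [d k], which thus vanishes for all [x] between 0 and 1. *)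
Lemma shell_pop_free (R : realFieldType) N (d : nat -> R) :
  (forall P, 0 < P < 1 / 2 -> \sum_(k < N.+1) shell_pop N P k * d k = 0) ->
  forall k, (k <= N)%N -> d k = 0.
Proof.
move=> H k kN; pose p := \poly_(k < N.+1) d k.
have rootp x : 0 < x < 1 -> root p x.
  move=> h; have x1 : 0 < 1 + x by lra.
  have /H : 0 < x / (1 + x) < 1 / 2.
    by rewrite divr_gt0 ?ltr_pdivrMr //=; lra.
  move=> E; apply/eqP; rewrite horner_poly.
  transitivity ((1 + x) ^+ N * (\sum_(k < N.+1) shell_pop N (x / (1 + x)) k * d k));
    last by rewrite E mulr0.
  rewrite mulr_sumr; apply: eq_bigr => i _; rewrite /shell_pop.
  have -> : 1 - x / (1 + x) = (1 + x)^-1 by field; lra.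
  rewrite expr_div_n exprVn.
  rewrite -[in (1 + x) ^+ N](subnK (ltn_ord i : (i <= N)%N)).
  have n0 m : (1 + x) ^+ m != 0 by rewrite expf_neq0 // gt_eqF.
  rewrite exprD; field.
  by rewrite !n0.
have p0 : p = 0.
  apply/eqP/negPn/negP => pn0.
  (* The [N + 1] distinct roots 1/2, 1/3, ... are too many for degree at most [N]. *)
  pose rs := [seq (i.+2%:R : R)^-1 | i <- iota 0 N.+1].
  have : (size rs < size p)%N.
    apply: max_poly_roots => //.
      apply/allP => _ /mapP[i _ ->]; apply: rootp.
      by rewrite invr_gt0 ltr0n /= invf_lt1 ?ltr0n // ltr1n.
    by rewrite map_inj_uniq ?iota_uniq // => i j /invr_inj/eqP; rewrite eqr_nat => /eqP[].
  by rewrite size_map size_iota ltnNge size_poly.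
by have := coef_poly N.+1 d k; rewrite -/p p0 coef0 ltnS kN.
Qed.

(* Layer-cake decomposition of [wt]: on each superlevel set of [wt], comparing
   with the threshold value of [q] reached on its preimage under [pi]. *)
Lemma monotone_transport_min (F : numDomainType) (I : finType) (D : I -> I -> F)
    (q : nat -> F) (h wt : I -> nat) (pi : {perm I}) :
  (forall r s, 0 <= D r s) -> (forall r, \sum_s D r s = 1) -> (forall s, \sum_r D r s = 1) ->
  (forall i, 0 <= q i) -> (forall i j, (i <= j)%N -> q j <= q i) ->
  (forall s s', (h s < h s')%N -> (wt (pi s) <= wt (pi s'))%N) ->
  \sum_s q (h s) * (wt (pi s))%:R <= \sum_r \sum_s (wt r)%:R * q (h s) * D r s.
Proof.
move=> D0 Dr Dc q0 qdec mono.
pose m := \max_i wt i.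
have wtE i : (wt i)%:R = \sum_(j < m) (j < wt i)%N%:R :> F.
  rewrite -natr_sum -big_mkcond /=; congr _%:R.
  have /(_ 0%N addn) <- := big_ord_widen m (fun=> 1%N) (leq_bigmax i : (wt i <= m)%N).
  by rewrite sum_nat_const card_ord muln1.
pose y j s := \sum_r (j < wt r)%N%:R * D r s.
rewrite (eq_bigr (fun s => \sum_(j < m) q (h s) * (j < wt (pi s))%N%:R)); last first.
  by move=> s _; rewrite wtE mulr_sumr.
rewrite exchange_big /=.
have -> : \sum_r \sum_s (wt r)%:R * q (h s) * D r s = \sum_(j < m) \sum_s q (h s) * y j s.
  rewrite exchange_big [RHS]exchange_big /=; apply: eq_bigr => s _.
  rewrite (eq_bigr (fun r => \sum_(j < m) q (h s) * ((j < wt r)%N%:R * D r s))).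
    by rewrite exchange_big; apply: eq_bigr => j _; rewrite mulr_sumr.
  by move=> r _; rewrite wtE !mulr_suml; apply: eq_bigr => j _; ring.
apply: ler_sum => j _.
have y0 s : 0 <= y j s by apply: sumr_ge0 => r _; rewrite mulr_ge0.
have y1 s : y j s <= 1.
  by rewrite -(Dc s); apply: ler_sum => r _; case: (_ < _)%N; rewrite ?mul1r ?mul0r.
have ysum : \sum_s y j s = \sum_s (j < wt (pi s))%N%:R.
  rewrite exchange_big /= [RHS](reindex_inj (@perm_inj _ (pi^-1)%g)) /=.
  by apply: eq_bigr => r _; rewrite -mulr_sumr Dr mulr1 permKV.
have [t tle tge] : exists2 t, (forall s, (j < wt (pi s))%N -> q (h s) <= t)
    & (forall s, (wt (pi s) <= j)%N -> t <= q (h s)).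
  (* The threshold [t] is the largest [q] on the preimage of the superlevel set; if that is empty, 0
     serves because [q] is nonnegative. *)
  have [s0 js0|none] := pickP (fun s => j < wt (pi s))%N; last first.
    by exists 0 => // s; rewrite none.
  case: (@arg_minnP _ s0 (fun s => j < wt (pi s))%N h js0) => s1 js1 s1min.
  exists (q (h s1)) => s js; first exact/qdec/s1min.
  apply: qdec; rewrite leqNgt; apply/negP => /mono; rewrite leqNgt.
  by rewrite (leq_ltn_trans js js1).
rewrite -subr_ge0 -sumrB.
(* Since [y j] and the indicator have the same total, [q] may be shifted by [t], which makes every
   term nonnegative. *)
have -> : \sum_s (q (h s) * y j s - q (h s) * (j < wt (pi s))%N%:R) =
    \sum_s (q (h s) - t) * (y j s - (j < wt (pi s))%N%:R).
  apply/eqP; rewrite -subr_eq0 -sumrB.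
  rewrite (eq_bigr (fun s => t * (y j s - (j < wt (pi s))%N%:R))).
    by rewrite -mulr_sumr sumrB ysum subrr mulr0.
  by move=> s _; ring.
apply: sumr_ge0 => s _; case: (ltnP j) => js.
  by rewrite mulr_le0 ?subr_le0 ?tle.
by rewrite subr0 mulr_ge0 ?subr_ge0 ?tge.
Qed.

(** * Operators *)

Lemma sum_enum_rank (V : nmodType) (I : finType) (F : 'I_#|I| -> V) :
  \sum_r F r = \sum_(x : I) F (enum_rank x).
Proof. by rewrite (reindex enum_rank) //; exact/onW_bij/enum_rank_bij. Qed.

Section Operators.
Variables (R : realType) (N : nat).
Implicit Types (pi : {perm bits N}) (P : R) (r s : 'I_#|{: bits N}|).

Lemma tensor_diag (A : 'I_N -> 'M[R[i]]_2) r s :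
  (forall i x y, x != y -> A i x y = 0) ->
  tensor A r s = (r == s)%:R * \prod_i A i (enum_val r i) (enum_val r i).
Proof.
move=> A0; rewrite mxE; have [->|rs] := eqVneq r s; first by rewrite mul1r.
rewrite mul0r; have /existsP[i ne] : [exists i, enum_val r i != enum_val s i].
  apply: contraR rs; rewrite negb_exists => /forallP E.
  by apply/eqP/enum_val_inj/ffunP => i; apply/eqP/negPn/E.
by rewrite (bigD1 i) //= A0 // mul0r.
Qed.

Lemma on_qubitE (a : 'I_N) r s :
  on_qubit a (delta_mx 1 1) r s = (r == s)%:R * (enum_val r a : nat)%:R :> R[i].
Proof.
rewrite /on_qubit tensor_diag => [|i x y xy]; last first.
  case: ifP => _; rewrite !mxE ?(negbTE xy) //.
  by case: (x =P 1) xy => [->|//]; rewrite eq_sym => /negbTE->.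
congr (_ * _); rewrite (bigD1 a) //= eqxx mxE andbb big1 ?mulr1 ?bit_eq1 // => i ia.
by rewrite (negbTE ia) mxE eqxx.
Qed.

Lemma target_numberE M r s :
  target_number R N M r s = (r == s)%:R * (weight M (enum_val r))%:R.
Proof.
rewrite /target_number summxE (eq_bigr (fun a => (r == s)%:R * (enum_val r a : nat)%:R)).
  by rewrite -mulr_sumr -natr_sum.
by move=> a _; rewrite on_qubitE.
Qed.

Lemma prod_shell_pop P (b : bits N) :
  \prod_i (if b i == 1 then P else 1 - P) = shell_pop N P (weight N b).
Proof.
rewrite (bigID (fun i => b i == 1)) /= mulrC /shell_pop.
have wE : weight N b = #|[pred i | b i == 1]|.
  rewrite -sum1_card big_mkcond /=; apply: eq_big => [i|i _]; first exact: ltn_ord.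
  by rewrite inE bit_eq1; case: ifP.
rewrite (eq_bigr (fun=> 1 - P)) => [|i /negbTE->] //.
rewrite [X in _ * X](eq_bigr (fun=> P)) => [|i ->] //.
rewrite !prodr_const wE; congr (_ ^+ _ * _).
have := cardC [pred i | b i == 1]; rewrite card_ord => /(canRL (addKn _)) <-.
exact: eq_card.
Qed.

Lemma thermalE P r s :
  thermal N P r s = (r == s)%:R * (shell_pop N P (weight N (enum_val r)))%:C.
Proof.
have dE (x y : 'I_2) : ((1 - P)%:C *: delta_mx 0 0 + P%:C *: delta_mx 1 1) x y =
    (x == y)%:R * (if x == 1 then P else 1 - P)%:C.
  rewrite !mxE; case: x y => [[|[|//]] ?] [[|[|//]] ?] /=;
  by rewrite -?val_eqE /= ?mulr1 ?mulr0 ?addr0 ?add0r ?mul1r ?mul0r.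
rewrite /thermal tensor_diag => [|i x y xy]; last by rewrite dE (negbTE xy) mul0r.
rewrite -prod_shell_pop rmorph_prod; congr (_ * _).
by apply: eq_bigr => i _; rewrite dE eqxx mul1r.
Qed.

Lemma evolve_thermalE (U : qop R N) P r s : evolve U (thermal N P) r s =
  \sum_u U r u * (shell_pop N P (weight N (enum_val u)))%:C * (U s u)^*.
Proof.
have -> : thermal N P = diag_mx (\row_u (shell_pop N P (weight N (enum_val u)))%:C).
  by apply/matrixP => u v; rewrite thermalE !mxE mulr_natl.
by rewrite /evolve mul_mx_diag mxE; apply: eq_bigr => u _; rewrite !mxE.
Qed.

(** Both the thermal state and the target number are diagonal, so [U] enters only through the
    squared moduli of its entries, a doubly stochastic matrix for unitary [U]: the trace is a
    transport cost. *)
Lemma trace_evolve M (U : qop R N) P :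
  \tr (target_number R N M *m evolve U (thermal N P)) =
  \sum_(b : bits N) \sum_(b' : bits N) (weight M b)%:R * (shell_pop N P (weight N b'))%:C
     * `|U (enum_rank b) (enum_rank b')| ^+ 2.
Proof.
have -> : target_number R N M = diag_mx (\row_u (weight M (enum_val u))%:R).
  by apply/matrixP => u v; rewrite target_numberE !mxE mulr_natl.
rewrite mul_diag_mx [LHS]sum_enum_rank.
apply: eq_bigr => b _; rewrite mxE evolve_thermalE mxE enum_rankK mulr_sumr.
rewrite sum_enum_rank; apply: eq_bigr => b' _.
by rewrite enum_rankK normCK !mulrA -!(mulrC _%:C) !mulrA.
Qed.

Lemma perm_opE pi b b' :
  perm_op R pi (enum_rank b) (enum_rank b') = (b == pi b')%:R.
Proof. by rewrite mxE !enum_rankK. Qed.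

Lemma evolve_perm pi P b b' :
  evolve (perm_op R pi) (thermal N P) (enum_rank b) (enum_rank b') =
  (b == b')%:R * (shell_pop N P (weight N ((pi^-1)%g b)))%:C.
Proof.
rewrite evolve_thermalE sum_enum_rank.
rewrite (bigD1 ((pi^-1)%g b)) //= !perm_opE permKV eqxx enum_rankK mul1r big1 ?addr0.
  by rewrite conjC_nat mulrC eq_sym.
move=> x ne; rewrite !perm_opE; case: eqP => [E|_]; last by rewrite !mul0r.
by rewrite E permK eqxx in ne.
Qed.

Lemma perm_op_unitary pi : perm_op R pi \is unitarymx.
Proof.
apply/unitarymxP/matrixP => r s; rewrite -[r]enum_valK -[s]enum_valK.
set b := enum_val r; set b' := enum_val s.
rewrite !mxE sum_enum_rank (inj_eq enum_rank_inj).
rewrite (bigD1 ((pi^-1)%g b)) //= !mxE !enum_rankK permKV eqxx mul1r conjC_nat eq_sym.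
rewrite big1 ?addr0 // => x ne; rewrite !mxE !enum_rankK; case: eqP => [E|_]; last by rewrite !mul0r.
by rewrite E permK eqxx in ne.
Qed.

Lemma trace_perm M pi P :
  \tr (target_number R N M *m evolve (perm_op R pi) (thermal N P)) =
  \sum_(b : bits N) (shell_pop N P (weight N b))%:C * (weight M (pi b))%:R.
Proof.
rewrite trace_evolve exchange_big /=; apply: eq_bigr => b _.
rewrite (bigD1 (pi b)) //= perm_opE eqxx normr1 expr1n mulr1 big1 ?addr0 1?mulrC //.
by move=> x ne; rewrite perm_opE (negbTE ne) normr0 expr0n mulr0.
Qed.

Lemma unitary_rows (U : qop R N) b : U \is unitarymx ->
  \sum_(b' : bits N) `|U (enum_rank b) (enum_rank b')| ^+ 2 = 1.
Proof.
move=> /unitarymxP/matrixP/(_ (enum_rank b) (enum_rank b)).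
rewrite !mxE eqxx mulr1n sum_enum_rank => <-.
by apply: eq_bigr => b' _; rewrite !mxE normCK.
Qed.

Lemma unitary_cols (U : qop R N) b' : U \is unitarymx ->
  \sum_(b : bits N) `|U (enum_rank b) (enum_rank b')| ^+ 2 = 1.
Proof.
rewrite -trmxC_unitary => /unitary_rows -/(_ b') <-.
by apply: eq_bigr => b _; rewrite !mxE norm_conjC.
Qed.

(** Optimality among permutations at the single value 1/4 of P1 already forces monotonicity, which
    does not involve P1 and gives the transport bound at every P1. *)
Lemma optimalP M pi : temp_indep_optimal R M pi <-> monotone M pi.
Proof.
split=> [opt|mono P hP U U_unit].
  have hP : 0 < (4%:R^-1 : R) < 1 / 2.
    by rewrite invr_gt0 ltr0n /= div1r ltf_pV2 ?posrE ?ltr0n // ltr_nat.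
  apply: (@minimal_monotone R[i] N M (fun k => (shell_pop N 4%:R^-1 k)%:C)).
    by move=> i j ij; rewrite ltcR shell_pop_lt.
  by move=> pi'; rewrite -!trace_perm; apply: opt => //; apply: perm_op_unitary.
rewrite trace_perm trace_evolve.
apply: (@monotone_transport_min _ _ (fun b b' => `|U (enum_rank b) (enum_rank b')| ^+ 2)
  (fun k => (shell_pop N P k)%:C) (weight N) (weight M)) => //.
- by move=> r s; rewrite exprn_ge0.
- by move=> b; apply: unitary_rows.
- by move=> b; apply: unitary_cols.
- by move=> k; rewrite ler0c shell_pop_ge0.
by move=> i j; rewrite leq_eqVlt => /predU1P[->//|ij]; rewrite lecR ltW // shell_pop_lt.
Qed.

Lemma reduced_permE pi P (a : 'I_N) x y :
  reduced (evolve (perm_op R pi) (thermal N P)) a x y =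
  (x == y)%:R * \sum_(b : bits N | pi b a == x) (shell_pop N P (weight N b))%:C.
Proof.
rewrite mxE (reindex_inj (@perm_inj _ pi)) /= mulr_sumr; apply: eq_bigr => b /eqP bx.
rewrite evolve_perm permK; congr (_%:R * _); congr (nat_of_bool _).
apply/eqP/eqP => [/ffunP/(_ a)|xy]; first by rewrite ffunE eqxx bx.
by apply/ffunP => i; rewrite ffunE; case: eqP => // ->; rewrite -xy.
Qed.

Lemma sum_excited pi P (a : 'I_N) :
  \sum_(b : bits N | pi b a == 1) shell_pop N P (weight N b) =
  \sum_(k < N.+1) shell_pop N P k * (shell_degree pi k a)%:R.
Proof.
rewrite (partition_big (fun b => inord (weight N b) : 'I_N.+1) xpredT) //=.
apply: eq_bigr => k _; rewrite natr_sum mulr_sumr big_mkcond [RHS]big_mkcond.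
apply: eq_bigr => b _; rewrite -(val_eqE (inord _) k) /= inordK ?ltnS ?weight_le // bit_eq1.
by case: (_ =P (k : nat)) => [->|_]; rewrite ?andbF // andbT; case: ifP; rewrite ?mulr1 ?mulr0.
Qed.

(** The marginals are diagonal with a common trace, so only their excited populations matter; these
    are combinations of the [shell_pop] with coefficients [shell_degree], and [shell_pop_free]
    compares coefficients. *)
Lemma identical_marginalsP M pi : identical_marginals R M pi <->
  forall k (a c : 'I_N), (a < M)%N -> (c < M)%N -> shell_degree pi k a = shell_degree pi k c.
Proof.
split=> [marg k a c aM cM|deg_eq P hP a c aM cM].
  have [kN|kN] := leqP k N; last first.
    rewrite /shell_degree !big_pred0 // => b; apply/negbTE;
    by rewrite neq_ltn (leq_ltn_trans (weight_le _ _) kN).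
  apply/eqP; rewrite -(eqr_nat R) -subr_eq0; apply/eqP.
  apply: (@shell_pop_free R N (fun k => (shell_degree pi k a)%:R - (shell_degree pi k c)%:R)) => // P hP.
  rewrite (eq_bigr _ (fun k _ => mulrBr _ _ _)) sumrB -!sum_excited.
  have := congr1 (fun A : 'M_2 => complex.Re (A 1 1)) (marg P hP a c aM cM).
  by rewrite !reduced_permE eqxx !mul1r -!rmorph_sum /= => ->; rewrite subrr.
apply/matrixP => x y; rewrite !reduced_permE; congr (_ * _).
have E1 : \sum_(b : bits N | pi b a == 1) (shell_pop N P (weight N b))%:C =
          \sum_(b : bits N | pi b c == 1) (shell_pop N P (weight N b))%:C.
  rewrite -!rmorph_sum; congr (_%:C); rewrite !sum_excited.
  by apply: eq_bigr => k _; rewrite (deg_eq _ a c).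
have [->//|x1] := eqVneq x 1.
have E0 d : \sum_(b : bits N | pi b d == x) (shell_pop N P (weight N b))%:C =
    \sum_(b : bits N) (shell_pop N P (weight N b))%:C -
    \sum_(b : bits N | pi b d == 1) (shell_pop N P (weight N b))%:C.
  apply/eqP; rewrite eq_sym subr_eq; apply/eqP.
  rewrite (bigID (fun b => pi b d == 1)) /= addrC; congr (_ + _).
  apply: eq_bigl => b; move: x1; case: x (pi b d) => [[|[|//]] ?] [[|[|//]] ?];
  by rewrite -!val_eqE.
by rewrite !E0 E1.
Qed.

End Operators.

(** * Divisibility criterion for equal marginals *)

Theorem theorem3 (R : realType) (N M : nat) (hM : (1 <= M)%N) (hMN : (M < N)%N) :
  (exists pi : {perm bits N},
      temp_indep_optimal R M pi /\ identical_marginals R M pi)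
  <->
  (forall w k : nat, (1 <= w)%N -> (w <= M - 1)%N -> (k <= N)%N ->
      (M %| w * passive_mult N M w k)%N).
Proof.
have leMN := ltnW hMN; split=> [[pi [/optimalP mono /identical_marginalsP deg_eq]] w k _ _ _|dvd].
  exact: dvdn_of_shell_degree deg_eq w k.
have [pi [mono deg_eq]] := balanced_exists hM leMN dvd.
by exists pi; split; [apply/optimalP|apply/identical_marginalsP].
Qed.
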